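(* There is an algorithm that, given a tree $T$ and a coloring $c$ of $T$, computes a $\gamma_{uc}$--dominating $c$--set of $(T,c)$ in time linear in the number of vertices of $T$.
   Context: A coloring of a graph $G=(V,E)$ is a map $c:V\to\{0,1,2,\dots\}$ with $c(u)\neq c(v)$ whenever $u,v$ are adjacent. Given $(G,c)$, a set $D\subseteq V$ is an up--color dominating $c$--set if (1) every vertex $v\notin D$ has a neighbor $d\in D$ with $c(v)<c(d)$, and (2) $D$ contains no vertex of color $0$. A $\gamma_{uc}$--dominating $c$--set is an up--color dominating $c$--set of minimum cardinality.
   Formalization: The set is required only when some up-color dominating c-set exists; this excludes exactly the one-vertex tree whose vertex has color 0, which has no such set (the algorithm must still halt in linear time there). *)

(* Defs.v *)
From mathcomp Require Import all_boot.

Set Implicit Arguments.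
Unset Strict Implicit.
Unset Printing Implicit Defensive.

Section Graphs.

Variables (V : finType) (e : rel V).

Definition simple_graph : Prop := symmetric e /\ irreflexive e.

Definition graph_connected : Prop := forall x y : V, connect e x y.

(** An edge traversed back and forth is a [ucycle] of size 2. *)
Definition acyclic : Prop :=
  forall s : seq V, 2 < size s -> ~ ucycle e s.

Definition is_tree : Prop :=
  [/\ 0 < #|V|, simple_graph, graph_connected & acyclic].

Variable c : V -> nat.

Definition coloring : Prop := forall u v : V, e u v -> c u <> c v.

(** A single vertex of color 0 admits no such set; every coloring of any other
    tree admits one. *)
Definition up_color_dominating (D : {set V}) : Prop :=
  (forall v : V, v \notin D -> exists d : V, [/\ d \in D, e v d & c v < c d])
  /\ (forall v : V, v \in D -> c v <> 0).

Definition gamma_uc_dominating (D : {set V}) : Prop :=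
  up_color_dominating D /\
  forall D' : {set V}, up_color_dominating D' -> #|D| <= #|D'|.

Definition adjacency_lists (al : V -> seq V) : Prop :=
  forall v : V, uniq (al v) /\ al v =i e v.

End Graphs.

(** A uniform-cost random access machine, programmed by structured programs
    over a random access memory of natural numbers, with addition, truncated
    subtraction and test against zero as the only arithmetic (there is no multiplication), each at unit cost.  The memory is
    split into banks; bank numbers are literals of the program, so a program
    uses only a fixed finite number k of banks, and cell i of bank b can be
    seen as cell k * i + b of a single memory. *)

Definition memory := nat -> nat -> nat.

Definition write (m : memory) (b i x : nat) : memory :=
  fun b' i' => if (b' == b) && (i' == i) then x else m b' i'.

Inductive expr : Type :=
| Num of nat
| Read of nat & expr
| Add of expr & expr
| Sub of expr & expr.

Fixpoint eval (m : memory) (x : expr) : nat :=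
  match x with
  | Num k => k
  | Read b i => m b (eval m i)
  | Add x1 x2 => eval m x1 + eval m x2
  | Sub x1 x2 => eval m x1 - eval m x2
  end.

Fixpoint expr_cost (x : expr) : nat :=
  match x with
  | Num _ => 1
  | Read _ i => (expr_cost i).+1
  | Add x1 x2 | Sub x1 x2 => (expr_cost x1 + expr_cost x2).+1
  end.

Inductive program : Type :=
| Skip
| Write of nat & expr & expr
| Seq of program & program
| If of expr & program & program
| While of expr & program.

(** [exec p m t m'] : started on memory [m], the program [p] halts with memory
    [m'] after [t] steps, one for each command executed and each node of each
    expression evaluated. *)
Inductive exec : program -> memory -> nat -> memory -> Prop :=
| ExecSkip m : exec Skip m 1 m
| ExecWrite m b i x :
    exec (Write b i x) m (expr_cost i + expr_cost x).+1
         (write m b (eval m i) (eval m x))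
| ExecSeq p q m t m' u m'' :
    exec p m t m' -> exec q m' u m'' -> exec (Seq p q) m (t + u).+1 m''
| ExecIfTrue x p q m t m' :
    eval m x <> 0 -> exec p m t m' -> exec (If x p q) m (expr_cost x + t).+1 m'
| ExecIfFalse x p q m t m' :
    eval m x = 0 -> exec q m t m' -> exec (If x p q) m (expr_cost x + t).+1 m'
| ExecWhileTrue x p m t m' u m'' :
    eval m x <> 0 -> exec p m t m' -> exec (While x p) m' u m'' ->
    exec (While x p) m (expr_cost x + t + u).+1 m''
| ExecWhileFalse x p m :
    eval m x = 0 -> exec (While x p) m (expr_cost x).+1 m.

(** Bank 0 holds the number n of vertices (in cell 0), bank 1 the colors.
    Bank 3 holds the concatenation of the adjacency lists of 0, ..., n-1, and
    bank 2 the offsets: the list of v occupies the cells i of bank 3 with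
    [off v <= i < off v.+1] (cells of bank 2 beyond n repeat [off n]).  All other
    cells initially contain 0. *)
Definition input_memory (n : nat) (al : 'I_n -> seq 'I_n) (c : 'I_n -> nat)
    : memory :=
  fun b i =>
    match b with
    | 0 => if i == 0 then n else 0
    | 1 => nth 0 (codom c) i
    | 2 => sumn (take i (shape (codom al)))
    | 3 => nth 0 (map val (flatten (codom al))) i
    | _ => 0
    end.

(** The result is left in bank 4 as a characteristic vector. *)
Definition outputs (n : nat) (m : memory) (D : {set 'I_n}) : Prop :=
  forall v : 'I_n, m 4 v = (v \in D).

(* Main.v *)
Require Import Defs.
From mathcomp Require Import all_boot zify.

(* all_boot also exports constants named Num, Sub, ...; those of Defs are meant. *)
Import Defs.

Set Implicit Arguments.
Unset Strict Implicit.
Unset Printing Implicit Defensive.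

(** Search the tree from a root of nonzero color, giving every other vertex a
    parent that precedes it in the order of discovery; by acyclicity every edge
    joins a vertex to its parent.  Then go through the vertices in reverse
    order and, whenever [v] is neither in [S] nor below a neighbor in [S], add to
    [S] the parent of [v] if its color is larger, and [v] itself otherwise.  The
    vertices at which [S] grows have pairwise disjoint closed up-neighborhoods:
    the vertex added at [v] is the only one of the neighborhood of [v] through
    which a vertex treated later could meet it, and it would dominate that later
    vertex.  Every dominating set meets all these neighborhoods, so [S] is
    minimum.  The time is linear because the degrees add up to at most [2 n]. *)

Section SearchOrder.

Variables (V : finType) (e : rel V) (r : V).

Definition search_order (s : seq V) (par : V -> V) : Prop :=
  [/\ uniq s, r \in s, par r = r &
      forall x, x \in s -> x != r -> e x (par x) /\ index (par x) s < index x s].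

Lemma search_order1 (par : V -> V) : par r = r -> search_order [:: r] par.
Proof. by move=> pr; split=> // [|x]; rewrite ?mem_head ?inE // => ->. Qed.

Lemma search_order_rcons (s : seq V) (par : V -> V) (v w : V) :
  search_order s par -> v \in s -> w \notin s -> e w v ->
  search_order (rcons s w) [fun x => par x with w |-> v].
Proof.
move=> [us rs pr ps] vs ws ewv.
have nw x : x \in s -> (x == w) = false by move=> xs; apply: contraNF ws => /eqP <-.
have ix x : x \in s -> index x (rcons s w) = index x s.
  by move=> xs; rewrite -cats1 index_cat xs.
split=> [|||x] /=; rewrite ?rcons_uniq ?ws ?mem_rcons ?inE ?rs ?orbT //.
  by rewrite nw.
have [-> _ _|_ /= xs xr] := eqVneq x w.
  rewrite ix //. by rewrite -cats1 index_cat (negbTE ws) /= eqxx addn0 index_mem.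
have [ex lx] := ps x xs xr; split=> //.
by rewrite !ix // -index_mem (ltn_trans lx) ?index_mem.
Qed.

Variables (s : seq V) (par : V -> V).
Hypotheses (tree : is_tree e) (so : search_order s par).

Lemma earlier_neighbor_unique (x y z : V) :
  e x y -> e x z -> index y s < index x s -> index z s < index x s -> y = z.
Proof.
have [us rs pr ps] := so; have [_ [sy irr] _ acy] := tree.
move=> exy exz yx zx; apply/eqP/negP => /negP yz.
pose e' := [rel a b | [&& e a b, index a s < index x s & index b s < index x s]].
have e'_sym : connect_sym e'.
  by apply: sym_connect_sym => a b /=; rewrite sy; congr andb; rewrite andbC.
have to_r a : index a s < index x s -> connect e' a r.
  have [k] := ubnP (index a s); elim: k a => // k IH a ak ax.
  have as_ : a \in s by rewrite -index_mem (leq_trans ax) ?index_size.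
  have [->//|ar] := eqVneq a r; have [ea la] := ps a as_ ar.
  apply: (connect_trans (y := par a)).
    by apply: connect1; rewrite /= ea ax (ltn_trans la).
  by apply: IH; [apply: leq_trans la _ | apply: ltn_trans la _].
have /connectP [p0 /shortenP [p pp up _] lp] : connect e' y z.
  by apply: connect_trans (to_r _ yx) _; rewrite e'_sym to_r.
have xp : x \notin y :: p.
  have /allP all_p : all (fun a => index a s < index x s) (y :: p).
    rewrite /= yx; elim: p (y) pp {up lp} => //= b p IH a /andP [] /and3P [_ _ ->].
    exact: IH.
  by apply/negP => /all_p; rewrite ltnn.
apply: (acy (x :: y :: p)).
  by case: p lp {pp up xp} => //= yz'; rewrite yz' eqxx in yz.
rewrite /ucycle /= xp exy rcons_path /= -lp (sy z) exz andbT.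
by rewrite (sub_path _ pp) // => a b /and3P [].
Qed.

Lemma search_order_edge (full : forall x, x \in s) (x y : V) : e x y ->
  (y = par x /\ index y s < index x s) \/ (x = par y /\ index x s < index y s).
Proof.
move=> exy; have [us rs pr ps] := so; have [_ [sy irr] _ _] := tree.
have r_first a : index a s < index r s -> False.
  have [k] := ubnP (index a s); elim: k a => // k IH a ak ar.
  have [E|na] := eqVneq a r; first by rewrite E ltnn in ar.
  have [_ la] := ps a (full a) na.
  by apply: (IH (par a)); [apply: leq_trans la _ | apply: ltn_trans la _].
have parent a b : e a b -> index b s < index a s -> b = par a.
  move=> eab ba; have [E|na] := eqVneq a r.
    by rewrite E in ba; case: (r_first b).
  by have [ea la] := ps a (full a) na; apply: (earlier_neighbor_unique (x := a)).
case: (ltngtP (index x s) (index y s)) => [xy|yx|E].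
- by right; split=> //; apply: parent; rewrite // sy.
- by left; split=> //; apply: parent.
- by rewrite -(nth_index r (full x)) E nth_index // irr in exy.
Qed.

Lemma sum_degree_le (full : forall x, x \in s) : \sum_x #|e x| <= 2 * #|V|.
Proof.
have le1 x : #|e x| <= 1 + \sum_y (par y == x).
  have <- : \sum_y (e x y : nat) = #|e x| 
    by rewrite -sum1_card [RHS]big_mkcond; apply: eq_bigr => y _; rewrite -topredE /=; case: e.
  rewrite (bigD1 (par x)) //= leq_add ?leq_b1 //.
  rewrite [X in _ <= X](bigD1 (par x)) //= (leq_trans _ (leq_addl _ _)) //.
  apply: leq_sum => y ypx; case exy: (e x y) => //.
  by case: (search_order_edge full exy) => [[E _]|[<- _]];
    [rewrite E eqxx in ypx | rewrite eqxx].
apply: leq_trans (leq_sum _ (fun x _ => le1 x)) _.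
rewrite big_split /= sum1_card exchange_big /= mul2n -addnn leq_add2l.
rewrite -[X in _ <= X]sum1_card; apply: leq_sum => y _.
rewrite (bigD1 (par y)) //= eqxx big1 // => x.
by rewrite eq_sym => /negbTE ->.
Qed.

End SearchOrder.

Section Greedy.

Variables (V : finType) (e : rel V) (c : V -> nat) (par : V -> V).

Definition greedy_step (v : V) (st : {set V} * {set V}) : {set V} * {set V} :=
  let S := if (v \in st.1) || (v \in st.2) then st.1
           else (if c v < c (par v) then par v else v) |: st.1 in
  (S, if (v \in S) && (c (par v) < c v) then par v |: st.2 else st.2).

Definition greedy (s : seq V) : {set V} * {set V} :=
  foldr greedy_step (set0, set0) s.

Definition target (v : V) : V := if c v < c (par v) then par v else v.

Definition up_closed_nbhd (v x : V) : bool :=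
  (x == v) || (e v x && (c v < c x)).

Definition greedy_invariant (s2 : seq V) (S F : {set V}) : Prop :=
  [/\ forall v, v \in s2 -> exists2 d, d \in S & up_closed_nbhd v d,
      forall v, v \in S -> c v <> 0,
      forall v, v \in F -> exists2 d, d \in S & up_closed_nbhd v d,
      forall w, w \in s2 -> w \in S -> c (par w) < c w -> par w \in F &
      exists W : {set V},
        [/\ #|S| <= #|W|,
            forall u, u \in W -> u \in s2 /\ target u \in S &
            forall u v x, u \in W -> v \in W ->
              up_closed_nbhd u x -> up_closed_nbhd v x -> u = v]].

Variables (r : V) (s : seq V).
Hypotheses (tree : is_tree e) (col : coloring e c) (cr : c r <> 0)
  (so : search_order e r s par) (full : forall x, x \in s).

Lemma witness_disjoint (s1 s2 : seq V) (v u x : V) (S F : {set V}) :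
  s = s1 ++ v :: s2 -> greedy_invariant s2 S F ->
  v \notin S -> v \notin F -> target v \notin S ->
  u \in s2 -> target u \in S ->
  up_closed_nbhd u x -> up_closed_nbhd v x -> False.
Proof.
move=> def_s [_ _ _ complete _] vS vF tvS us tuS.
have edge := search_order_edge tree so full.
have us_ : uniq s by have [] := so.
have later y : (y \in s2) = (index v s < index y s).
  have : uniq (s1 ++ v :: s2) by rewrite -def_s.
  rewrite cat_uniq => /and3P [_ /hasPn h] /= /andP [vs2 _].
  have vs1 : v \notin s1 by apply: h; apply: mem_head.
  rewrite def_s !index_cat (negbTE vs1) /= eqxx addn0.
  have [ys1|ys1] := boolP (y \in s1).
    rewrite ltnNge ltnW ?index_mem //=; apply: contraTF ys1 => ys2.
    by apply: h; rewrite inE ys2 orbT.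
  have [E|yv] := eqVneq v y; first by rewrite addn0 ltnn -E (negbTE vs2).
  have := full y; rewrite def_s mem_cat (negbTE ys1) inE eq_sym (negbTE yv) /= => ->.
  by rewrite addnS ltnS leq_addr.
have vu : index v s < index u s by rewrite -later.
have asym a b : index a s < index b s -> index b s < index a s -> False.
  by move=> ab /(ltn_trans ab); rewrite ltnn.
case/orP=> [/eqP ->|/andP [eux cux]].
  case/orP=> [/eqP E|/andP [evu cvu]]; first by rewrite E ltnn in vu.
  case: (edge _ _ evu) => [[_ /(asym _ _ vu)]//|[E _]].
  case/negP: vF; rewrite E; apply: complete; rewrite -?E //.
  by move: tuS; rewrite /target -E ltnNge ltnW.
case: (edge _ _ eux) => [[E xu]|[E ux]].
  have xS : x \in S by move: tuS; rewrite /target -E cux.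
  case/orP=> [/eqP xv|/andP [evx cvx]]; first by rewrite -xv xS in vS.
  case: (edge _ _ evx) => [[Ev _]|[Ev vx]].
    by move: tvS; rewrite /target -Ev cvx xS.
  by case/negP: vF; rewrite Ev; apply: complete; rewrite -?Ev ?later.
case/orP=> [/eqP xv|/andP [evx cvx]].
  by apply: (asym _ _ vu); rewrite -xv.
case: (edge _ _ evx) => [[_ xv]|[Ev _]].
  by apply: (asym _ _ vu); apply: ltn_trans xv.
by rewrite E -Ev ltnn in vu.
Qed.

Lemma greedy_step_invariant (s1 s2 : seq V) (v : V) (S F : {set V}) :
  s = s1 ++ v :: s2 -> greedy_invariant s2 S F ->
  greedy_invariant (v :: s2) (greedy_step v (S, F)).1 (greedy_step v (S, F)).2.
Proof.
move=> def_s inv; have disj := fun u x => @witness_disjoint _ _ v u x _ _ def_s inv.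
have [dom nz sound complete [W [SW Ws2 Wd]]] := inv.
have [us _ pr ps] := so.
have vs2 : v \notin s2.
  by move: us; rewrite def_s cat_uniq => /and3P [_ _ /= /andP []].
have par_v : v != r -> e v (par v) /\ par v \notin s2.
  move=> vr; have [ev lv] := ps v (full v) vr; split=> //.
  apply/negP => pin; move: lv us; rewrite def_s cat_uniq !index_cat.
  move=> lv /and3P [_ /hasPn h _].
  have p1 : par v \notin s1 by apply: h; rewrite inE pin orbT.
  have v1 : v \notin s1 by apply: h; rewrite mem_head.
  by move: lv; rewrite (negbTE p1) (negbTE v1) /= eqxx addn0 ltnNge leq_addr.
have tgt_nz : c (target v) <> 0.
  rewrite /target; case: ltnP => [lt E|]; first by rewrite E in lt.
  have [->//|vr] := eqVneq v r; have [ev _] := par_v vr.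
  by move=> + E; rewrite E leqn0 => /eqP E'; by case: (col ev); rewrite E E'.
have tgt_nb : up_closed_nbhd v (target v).
  rewrite /target /up_closed_nbhd; case: ltnP => [lt|]; last by rewrite eqxx.
  have [E|vr] := eqVneq v r; first by rewrite E pr ltnn in lt.
  by have [-> _] := par_v vr; rewrite lt orbT.
have tgt_s2 w : w \in s2 -> w != target v.
  move=> ws2; apply/eqP => E; rewrite E /target in ws2; move: ws2.
  case: ltnP => [lt ps2|_ E2]; last by rewrite E2 in vs2.
  have [Er|vr] := eqVneq v r; first by rewrite Er pr ltnn in lt.
  by have [_] := par_v vr; rewrite ps2.
rewrite /greedy_step /= -/(target v).
set S' := if _ then _ else _; set F' := if _ then _ else _.
have SS' : {subset S <= S'} by rewrite /S' => x xS; case: ifP; rewrite ?inE ?xS ?orbT.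
have FF' : {subset F <= F'} by rewrite /F' => x xF; case: ifP; rewrite ?inE ?xF ?orbT.
have dom_v : exists2 d, d \in S' & up_closed_nbhd v d.
  rewrite /S'; case: ifP => [/orP [vS|/sound //]|_].
    by exists v; rewrite // /up_closed_nbhd eqxx.
  by exists (target v); rewrite ?setU11.
split.
- move=> x; rewrite inE => /orP [/eqP -> //|/dom [d dS dn]].
  by exists d; rewrite ?SS'.
- move=> x; rewrite /S'; case: ifP => _; first exact: nz.
  by rewrite inE => /orP []; [rewrite inE => /eqP -> | apply: nz].
- have old x : x \in F -> exists2 d, d \in S' & up_closed_nbhd x d.
    by case/sound=> d dS dn; exists d; rewrite ?SS'.
  move=> x; rewrite /F'; case: ifP => [/andP [vS' lt]|_]; last exact: old.
  rewrite inE => /orP []; last exact: old.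
  rewrite inE => /eqP ->; exists v; rewrite // /up_closed_nbhd lt andbT.
  have [E|vr] := eqVneq v r; first by rewrite E pr ltnn in lt.
  by have [_ [sy _] _ _] := tree; have [ev _] := par_v vr; rewrite sy ev orbT.
- move=> w; rewrite inE => /orP [/eqP ->|ws2] wS lt.
    by rewrite /F' wS lt setU11.
  apply/FF'/complete => //; move: wS; rewrite /S'; case: ifP => // _.
  by rewrite !inE (negbTE (tgt_s2 w ws2)).
have keep : S' = S -> exists W0 : {set V}, [/\ #|S'| <= #|W0|,
    forall u, u \in W0 -> u \in v :: s2 /\ target u \in S' &
    forall u u' x, u \in W0 -> u' \in W0 -> up_closed_nbhd u x ->
      up_closed_nbhd u' x -> u = u'].
  move=> ->; exists W; split=> // u /Ws2 [us2 tu].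
  by rewrite inE us2 orbT.
have [vSF|] := boolP ((v \in S) || (v \in F)); first by apply: keep; rewrite /S' vSF.
move=> nSF; have defS' : S' = target v |: S by rewrite /S' (negbTE nSF).
move: (nSF); rewrite negb_or => /andP [vS vF].
have [tS|tS] := boolP (target v \in S).
  by apply: keep; rewrite defS'; apply/setUidPr; rewrite sub1set.
have vW : v \notin W by apply/negP => /Ws2 []; rewrite (negbTE vs2).
have vWd u x : u \in W -> up_closed_nbhd u x -> up_closed_nbhd v x -> False.
  by case/Ws2=> us2 tu; apply: disj.
exists (v |: W); split.
- by rewrite defS' !cardsU1 tS vW leq_add2l.
- move=> u; rewrite !inE => /orP [/eqP ->|/Ws2 [us2 tu]].
    by rewrite eqxx defS' setU11.
  by rewrite us2 orbT SS'.
- move=> u u' x; rewrite !inE => /orP [/eqP ->|uW] /orP [/eqP ->|u'W] // h h'.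
  + by case: (vWd u' x).
  + by case: (vWd u x).
  + exact: Wd h h'.
Qed.

Lemma greedy_invariantP (s1 s2 : seq V) : s = s1 ++ s2 ->
  greedy_invariant s2 (greedy s2).1 (greedy s2).2.
Proof.
elim: s2 s1 => [|v s2 IH] s1 def_s.
  split=> //= [v|v|]; rewrite ?inE //.
  by exists set0; split=> // [u|u v x]; rewrite inE.
have := IH (rcons s1 v); rewrite cat_rcons => /(_ def_s).
rewrite /greedy /=; case: (foldr _ _ s2) => S F; exact: greedy_step_invariant def_s.
Qed.

Lemma greedy_gamma_uc : gamma_uc_dominating e c (greedy s).1.
Proof.
have [dom nz _ _ [W [SW _ Wd]]] := @greedy_invariantP [::] s erefl.
split; first split=> // v vS.
  have [d dS] := dom v (full v); case/orP=> [/eqP E|/andP [ev lt]]; last by exists d.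
  by rewrite E (negbTE vS) in dS.
move=> D [Ddom Dnz]; apply: leq_trans SW _.
pose f u := odflt u [pick x in D | up_closed_nbhd u x].
have fP u : f u \in D /\ up_closed_nbhd u (f u).
  rewrite /f; case: pickP => [x /andP [] //|none] /=.
  have := none u; rewrite /up_closed_nbhd eqxx andbT => /negbT uD.
  have [d [dD ed lt]] := Ddom u uD.
  by have := none d; rewrite /= dD /up_closed_nbhd ed lt orbT.
have f_inj : {in W &, injective f}.
  move=> u v uW vW E; apply: (Wd u v (f u) uW vW); first by have [] := fP u.
  by rewrite E; have [] := fP v.
rewrite -(card_in_imset f_inj); apply/subset_leq_card/subsetP => _ /imsetP [u _ ->].
by have [] := fP u.
Qed.

End Greedy.

Fixpoint loop_free (p : program) : bool :=
  match p with
  | Seq p q | If _ p q => loop_free p && loop_free q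
  | While _ _ => false
  | _ => true
  end.

Fixpoint run (p : program) (m : memory) : memory :=
  match p with
  | Write b i x => write m b (eval m i) (eval m x)
  | Seq p q => run q (run p m)
  | If x p q => if eval m x == 0 then run q m else run p m
  | _ => m
  end.

Fixpoint cost_bound (p : program) : nat :=
  match p with
  | Write _ i x => (expr_cost i + expr_cost x).+1
  | Seq p q => (cost_bound p + cost_bound q).+1
  | If x p q => (expr_cost x + (cost_bound p + cost_bound q)).+1
  | _ => 1
  end.

Lemma exec_run (p : program) (m : memory) : loop_free p ->
  exists2 t, exec p m t (run p m) & t <= cost_bound p.
Proof.
elim: p m => [|b i x|p IHp q IHq|x p IHp q IHq|//] m /=.
- by move=> _; exists 1 => //; apply: ExecSkip.
- by move=> _; exists (expr_cost i + expr_cost x).+1 => //; apply: ExecWrite.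
- case/andP=> /(IHp m) [t pt tp] /(IHq (run p m)) [u qu uq].
  by exists (t + u).+1; [apply: ExecSeq pt qu | rewrite ltnS leq_add].
case/andP=> /(IHp m) [t pt tp] /(IHq m) [u qu uq].
have [E|/eqP E] := eqVneq (eval m x) 0.
  exists (expr_cost x + u).+1; first exact: ExecIfFalse.
  by rewrite ltnS leq_add2l (leq_trans uq) ?leq_addl.
exists (expr_cost x + t).+1; first exact: ExecIfTrue.
by rewrite ltnS leq_add2l (leq_trans tp) ?leq_addr.
Qed.

Lemma exec_while (I : nat -> memory -> Prop) (x : expr) (p : program)
    (N k : nat) (m : memory) : loop_free p ->
  (forall k m, I k m -> eval m x <> 0 -> k < N /\ I k.+1 (run p m)) ->
  I k m ->
  exists t m' k', [/\ exec (While x p) m t m',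
    t <= (expr_cost x + cost_bound p).+1 * (N - k).+1, I k' m' & eval m' x = 0].
Proof.
move=> lf step; have [j] := ubnP (N - k); elim: j k m => // j IH k m lt Ikm.
have [E|/eqP E] := eqVneq (eval m x) 0.
  exists (expr_cost x).+1, m, k; split=> //; first exact: ExecWhileFalse.
  by apply: leq_trans (leq_pmulr _ _); lia.
have [kN Ik'] := step k m Ikm E; have [t pt tp] := exec_run m lf.
have [|u [m' [k' [wu uw Im' E']]]] := IH k.+1 (run p m) _ Ik'; first lia.
exists (expr_cost x + t + u).+1, m', k'; split=> //; first exact: ExecWhileTrue wu.
have -> : (N - k).+1 = (N - k.+1).+2 by lia.
by rewrite mulnS; lia.
Qed.

(* Bank 5 is the queue, and banks 6 and 7 hold the parent and the visited mark
   of each vertex.  Bank 8 marks the vertices with an up-neighbour in bank 4.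
   Cells 0, 1 and 2 of bank 9 are, during the search, the head and the tail of
   the queue and the current position in bank 3, then, during the greedy pass, the
   number of queue entries left, the current vertex and its parent. *)
Definition reg (i : nat) : expr := Read 9 (Num i).
Definition set_reg (i : nat) (x : expr) : program := Write 9 (Num i) x.

Definition search_init : program :=
  let root := Read 5 (Num 0) in
  Seq (If (Read 1 (Num 0)) Skip (Write 5 (Num 0) (Read 3 (Num 0))))
  (Seq (Write 6 root root)
  (Seq (Write 7 root (Num 1))
  (Seq (set_reg 1 (Num 1)) (set_reg 2 (Read 2 root))))).

Definition search_body : program :=
  let v := Read 5 (reg 0) in
  let w := Read 3 (reg 2) in
  If (Sub (Read 2 (Add v (Num 1))) (reg 2))
     (Seq (If (Read 7 w) Skip
              (Seq (Write 6 w v)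
              (Seq (Write 7 w (Num 1))
              (Seq (Write 5 (reg 1) w) (set_reg 1 (Add (reg 1) (Num 1)))))))
          (set_reg 2 (Add (reg 2) (Num 1))))
     (Seq (set_reg 0 (Add (reg 0) (Num 1))) (set_reg 2 (Read 2 v))).

Definition greedy_load : program :=
  Seq (set_reg 0 (Sub (reg 0) (Num 1)))
  (Seq (set_reg 1 (Read 5 (reg 0))) (set_reg 2 (Read 6 (reg 1)))).

Definition greedy_select : program :=
  let v := reg 1 in
  let p := reg 2 in
  If (Add (Read 4 v) (Read 8 v)) Skip
     (If (Sub (Read 1 p) (Read 1 v)) (Write 4 p (Num 1)) (Write 4 v (Num 1))).

Definition greedy_mark : program :=
  let v := reg 1 in
  let p := reg 2 in
  If (Read 4 v) (If (Sub (Read 1 v) (Read 1 p)) (Write 8 p (Num 1)) Skip) Skip.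

Definition greedy_body : program := Seq greedy_load (Seq greedy_select greedy_mark).

Definition search_cond : expr := Sub (reg 1) (reg 0).

Definition algorithm : program :=
  Seq search_init (Seq (While search_cond search_body) (While (reg 0) greedy_body)).

Lemma run_search_body (m : memory) :
  run search_body m =
    let v := m 5 (m 9 0) in
    let w := m 3 (m 9 2) in
    if m 2 (v + 1) - m 9 2 == 0
    then write (write m 9 0 (m 9 0 + 1)) 9 2 (m 2 (m 5 (m 9 0 + 1)))
    else write (if m 7 w == 0
                then write (write (write (write m 6 w v) 7 w 1) 5 (m 9 1) w)
                           9 1 (m 9 1 + 1)
                else m) 9 2 (m 9 2 + 1).
Proof.
rewrite /search_body [LHS]/=; case: eqP => // _.
by case: eqP.
Qed.

Section Search.

Variables (n : nat) (e : rel 'I_n) (c : 'I_n -> nat) (al : 'I_n -> seq 'I_n).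

Let input := input_memory al c.

Lemma input_color (v : 'I_n) : input 1 v = c v.
Proof. by rewrite /input /= (nth_map v) ?size_enum_ord // nth_ord_enum. Qed.

Lemma nth_codom_al (v : 'I_n) : nth [::] (codom al) v = al v.
Proof. by rewrite (nth_map v) ?size_enum_ord // nth_ord_enum. Qed.

Lemma input_offset_next (v : 'I_n) : input 2 v.+1 = input 2 v + size (al v).
Proof.
have lt : v < size (shape (codom al)) by rewrite size_map size_codom card_ord.
rewrite /input /= (take_nth 0 lt) sumn_rcons (nth_map [::]) ?nth_codom_al //.
by rewrite size_codom card_ord.
Qed.

Lemma input_adjacency (v w : 'I_n) (d : nat) : d < size (al v) ->
  input 3 (input 2 v + d) = nth w (al v) d.
Proof.
move=> lt; have vs : v < size (shape (codom al)).
  by rewrite size_map size_codom card_ord.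
have ds : d < nth 0 (shape (codom al)) v.
  by rewrite (nth_map [::]) ?nth_codom_al // size_codom card_ord.
have := nth_flatten w (codom al) (flatten_index (shape (codom al)) v d).
rewrite /= flatten_indexKl ?flatten_indexKr // nth_codom_al => <-.
rewrite /input /= (nth_map w) // size_flatten.
rewrite -[X in _ < sumn X](cat_take_drop v) sumn_cat ltn_add2l (drop_nth 0 vs) /=.
exact: leq_trans (leq_addr _ _).
Qed.

Definition frame (m : memory) : Prop :=
  [/\ m 1 =1 input 1, m 2 =1 input 2, m 3 =1 input 3, m 4 =1 input 4
    & m 8 =1 input 8].

Variable (r : 'I_n).
Hypotheses (tree : is_tree e) (adj : adjacency_lists e al).

Definition search_state (s : seq 'I_n) (par : 'I_n -> 'I_n) (h d : nat)
    (m : memory) : Prop :=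
  [/\ frame m,
      [/\ m 9 0 = h, m 9 1 = size s &
          h < size s -> m 9 2 = input 2 (nth r s h) + d],
      forall i, i < size s -> m 5 i = nth r s i,
      forall x : 'I_n, m 7 x = (x \in s) &
      forall x : 'I_n, x \in s -> m 6 x = par x].

Definition search_invariant (k : nat) (m : memory) : Prop :=
  exists s par h d,
    [/\ search_state s par h d m, search_order e r s par,
        h <= size s /\ (h = size s -> d = 0),
        forall x y, x \in take h s -> e x y -> y \in s &
        [/\ h < size s -> d <= size (al (nth r s h)),
            h < size s -> {subset take d (al (nth r s h)) <= s} &
            k = h + \sum_(x <- take h s) size (al x) + d]].

Lemma search_step (k : nat) (m : memory) :
  search_invariant k m -> eval m search_cond <> 0 ->
  k < n + \sum_x size (al x) /\ search_invariant k.+1 (run search_body m).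
Proof.
case=> s [par [h [d [st so [hs _] done [dv dsub ->]]]]].
have [fr [m90 m91 m92] m5 m7 m6] := st.
have -> : eval m search_cond = size s - h by rewrite /= m90 m91.
move=> cond; have lt : h < size s by lia.
have {}dv := dv lt; have {}dsub := dsub lt; have {}m92 := m92 lt.
have [us rs _ _] := so.
pose v := nth r s h; rewrite -/v in dv dsub m92.
have vs : v \in s by apply: mem_nth.
have sum_next : \sum_(x <- take h.+1 s) size (al x) =
                \sum_(x <- take h s) size (al x) + size (al v).
  by rewrite (take_nth r lt) -cats1 big_cat big_seq1.
have [m1E m2E m3E _ _] := fr.
split.
  have sn : size s <= n by rewrite -(card_uniqP us) -[X in _ <= X]card_ord max_card.
  have : \sum_(x <- take h.+1 s) size (al x) <= \sum_x size (al x).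
    by rewrite big_uniq ?take_uniq // big_mkcond leq_sum // => x _; case: ifP.
  by rewrite sum_next; lia.
have m5v : m 5 (m 9 0) = v by rewrite m90 m5.
have offv : m 2 (v + 1) = m 2 v + size (al v).
  by rewrite addn1 !m2E input_offset_next.
rewrite run_search_body /= m5v offv m92 m2E subnDl.
have [E|nE] := eqVneq (size (al v) - d) 0.
  have dE : d = size (al v) by lia.
  exists s, par, h.+1, 0; split=> //.
  - split=> //; split=> //=; first by rewrite m90 addn1.
    by move=> lt'; rewrite /write /= m90 addn1 (m5 _ lt') m2E addn0.
  - by move=> x y; rewrite (take_nth r lt) mem_rcons inE => /orP [/eqP -> evy|/done];
      [apply: dsub; rewrite dE take_size; have [_ ->] := adj v | apply].
  - by split=> // [_ x|]; rewrite ?take0 // sum_next dE; lia.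
have ld : d < size (al v) by lia.
pose w := nth r (al v) d.
have evw : e v w by have [_ E] := adj v; rewrite -[e v w]E mem_nth.
have m3w : m 3 (m 9 2) = w by rewrite m92 m3E (input_adjacency r).
rewrite -m92 m3w m7.
have [ws|ws] := boolP (w \in s); rewrite [_ == 0]/=.
  exists s, par, h, d.+1; split=> //.
  - by split=> //; split=> //= _; rewrite /write /= m92 addn1 addnS.
  - by split=> //; lia.
  - split=> // [_ x|]; last by rewrite addnS.
    by rewrite (take_nth r ld) mem_rcons inE => /orP [/eqP ->|/dsub].
have ew : e w v by have [_ [sy _] _ _] := tree; rewrite sy.
have rc i : i < size s -> nth r (rcons s w) i = nth r s i.
  by move=> lti; rewrite nth_rcons lti.
have eqw (x : 'I_n) : (x == w :> nat) = (x == w) by [].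
exists (rcons s w), [fun x => par x with w |-> v], h, d.+1; split=> //.
- split=> //; first split=> //=.
  + by rewrite /write /= m91 size_rcons addn1.
  + by rewrite /write /= rc // m92 addn1 addnS.
  + move=> i; rewrite size_rcons ltnS => lei; rewrite /write /= nth_rcons m91.
    by case: (ltngtP i (size s)) lei => // lti _; rewrite m5.
  + by move=> x; rewrite /write /= eqw mem_rcons inE m7; case: eqP.
  + move=> x; rewrite /write /= eqw mem_rcons inE; case: eqP => //= _; exact: m6.
- exact: search_order_rcons.
- by rewrite size_rcons; lia.
- move=> x y; rewrite -cats1 takel_cat // => /done h1 /h1.
  by rewrite mem_cat => ->.
- split=> [_|_ x|]; first by rewrite rc.
  + rewrite rc // (take_nth r ld) -/w !mem_rcons !inE => /orP [->//|/dsub ->].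
    by rewrite orbT.
  + by rewrite -cats1 takel_cat // addnS.
Qed.

Lemma search_complete (k : nat) (m : memory) :
  search_invariant k m -> eval m search_cond = 0 ->
  exists s par, [/\ search_order e r s par, forall x, x \in s & search_state s par n 0 m].
Proof.
case=> s [par [h [d [st so [hs d0] done _]]]].
have [_ [m90 m91 _] _ _ _] := st.
have -> : eval m search_cond = size s - h by rewrite /= m90 m91.
move=> ends; have hE : h = size s by lia.
have [us rs _ _] := so.
have full x : x \in s.
  have [_ _ conn _] := tree.
  have [p pp ->] := connectP (conn r x).
  elim: p r rs pp => //= y p IH z zs /andP [ezy]; apply: IH.
  by apply: done ezy; rewrite hE take_size.
have sn : size s = n by rewrite -(card_uniqP us) -[RHS]card_ord; apply: eq_card.
by exists s, par; split=> //; rewrite -{1}sn -hE -(d0 hE).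
Qed.

Lemma sum_adjacency_le (s : seq 'I_n) (par : 'I_n -> 'I_n) :
  search_order e r s par -> (forall x, x \in s) -> \sum_x size (al x) <= 2 * n.
Proof.
move=> so full; rewrite -[n in 2 * n]card_ord.
apply: leq_trans (sum_degree_le tree so full); apply: leq_sum => x _.
by have [ux ex] := adj x; rewrite -(card_uniqP ux) (eq_card ex).
Qed.

End Search.

Section Correctness.

Variables (n : nat) (e : rel 'I_n) (c : 'I_n -> nat) (al : 'I_n -> seq 'I_n).
Hypotheses (tree : is_tree e) (col : coloring e c) (adj : adjacency_lists e al).

Let input := input_memory al c.

Lemma search_init_invariant : exists r : 'I_n,
  search_invariant e c al r 0 (run search_init input) /\
  ((exists D, up_color_dominating e c D) -> c r <> 0).
Proof.
have n_gt0 : 0 < n by case: tree; rewrite card_ord.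
pose x0 := Ordinal n_gt0.
have [r [rE rnz]] : exists r : 'I_n,
    (if input 1 0 == 0 then input 3 0 else 0) = r /\
    ((exists D, up_color_dominating e c D) -> c r <> 0).
  rewrite (input_color c al x0 : input 1 0 = c x0); have [c0|/eqP cx0] := eqVneq (c x0) 0; last first.
    by exists x0.
  have [r rE] : exists r : 'I_n, input 3 0 = r.
    rewrite /input /=; case: flatten => [|y l] /=; last by exists y.
    by exists x0.
  exists r; split=> // [[D [dom nz]]] cr.
  have [|d [dD ed lt]] := dom x0; first by apply/negP => /nz.
  have [_ al0] := adj x0.
  have al_d : d \in al x0 by rewrite al0.
  have size0 : 0 < size (al x0) by case: (al x0) al_d.
  have off0 : input_memory al c 2 x0 = 0 by rewrite /= take0.
  have := input_adjacency c r size0; rewrite off0 -/input rE => /val_inj rn.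
  have er : e x0 r by rewrite -[e x0 r]al0 rn mem_nth.
  by case: (col er); rewrite cr.
exists r; split=> //.
have runE : run search_init input = write (write (write (write
    (if input 1 0 == 0 then write input 5 0 (input 3 0) else input)
    6 r r) 7 r 1) 9 1 1) 9 2 (input 2 r).
  by rewrite /search_init [LHS]/= -rE; case: (input 1 0 == 0).
have eqw (x : 'I_n) : (x == r :> nat) = (x == r) by [].
exists [:: r], id, 0, 0; rewrite runE; split=> //.
- split=> //=.
  + by case: ifP.
  + by rewrite /write /= addn0; case: ifP.
  + by case=> // _; rewrite /write /= -rE; case: ifP.
  + by move=> x; rewrite /write /= eqw inE; case: (x == r) => //; case: ifP.
  + by move=> x; rewrite /write inE /= eqw => /eqP ->; rewrite eqxx.
- exact: search_order1.
- by split=> // [_ x|]; rewrite take0 // big_nil.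
Qed.

Definition greedy_state (s : seq 'I_n) (par : 'I_n -> 'I_n) (h : nat)
    (st : {set 'I_n} * {set 'I_n}) (m : memory) : Prop :=
  [/\ m 9 0 = h, m 1 =1 input 1, forall i (x0 : 'I_n), i < n -> m 5 i = nth x0 s i &
      [/\ forall x : 'I_n, m 6 x = par x, outputs m st.1 &
          forall x : 'I_n, m 8 x = (x \in st.2)]].

Lemma write_member (m : memory) (b : nat) (A : {set 'I_n}) (i : 'I_n) :
  (forall x : 'I_n, m b x = (x \in A)) ->
  forall x : 'I_n, write m b i 1 b x = (x \in i |: A).
Proof.
move=> mA x; rewrite /write eqxx /= !inE mA.
by rewrite -[(x == i :> nat)]/(x == i); case: (x == i).
Qed.

Lemma run_greedy_body (s : seq 'I_n) (par : 'I_n -> 'I_n) (h : nat) (v : 'I_n)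
    (st : {set 'I_n} * {set 'I_n}) (m : memory) :
  greedy_state s par h.+1 st m -> m 5 h = v ->
  greedy_state s par h (greedy_step c par v st) (run greedy_body m).
Proof.
case=> m90 m1 m5 [m6 m4 m8] m5v; set p := par v.
have load : run greedy_load m = write (write (write m 9 0 h) 9 1 v) 9 2 p.
  have h_eq : h = m 9 0 - 1 by rewrite m90 subn1.
  have := m6 v; rewrite -m5v h_eq => <-; exact: erefl.
set m' := write _ 9 2 p in load.
have select : run greedy_select m' =
    if (v \in st.1) || (v \in st.2) then m'
    else write m' 4 (if c v < c p then p else v) 1.
  have -> : run greedy_select m' = if m 4 v + m 8 v == 0 then
    if m 1 p - m 1 v == 0 then write m' 4 v 1 else write m' 4 p 1 else m' by [].
  rewrite m4 m8 !m1 /input !input_color subn_eq0 leqNgt.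
  by case: (v \in st.1); case: (v \in st.2) => //=; case: (c v < c p).
set S := (greedy_step c par v st).1.
set m4' := run greedy_select m' in select.
have [keep4 sel4] : (forall b i, b != 4 -> m4' b i = m' b i) /\ outputs m4' S.
  rewrite select /S /greedy_step -/p /=; case: ifP => _; first by split.
  split=> [b i b4|x]; first by rewrite /write (negbTE b4).
  by case: ifP => _; apply: write_member.
have mark : run greedy_mark m4' =
    if (v \in S) && (c p < c v) then write m4' 8 p 1 else m4'.
  have -> : run greedy_mark m4' = if m4' 4 (m4' 9 1) == 0 then m4' else
    if m4' 1 (m4' 9 1) - m4' 1 (m4' 9 2) == 0 then m4'
    else write m4' 8 (m4' 9 2) 1 by [].
  rewrite !(keep4 9) // !(keep4 1) // -[m' 9 1]/(val v) -[m' 9 2]/(val p) sel4.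
  rewrite -[m' 1 v]/(m 1 v) -[m' 1 p]/(m 1 p) !m1 /input !input_color subn_eq0 leqNgt.
  by case: (v \in S) => //=; case: (c p < c v).
have -> : run greedy_body m = run greedy_mark m4' by rewrite /m4' -load.
have keep8 b i : b != 8 -> run greedy_mark m4' b i = m4' b i.
  by rewrite mark; case: ifP => // _ b8; rewrite /write (negbTE b8).
split=> [|i|i x0 lt|]; first by rewrite keep8 ?keep4.
- by rewrite keep8 ?keep4 // -m1.
- by rewrite keep8 ?keep4 // -m5.
split=> x; [by rewrite keep8 ?keep4 // -m6 | by rewrite keep8 | ].
have m8x (y : 'I_n) : m4' 8 y = (y \in st.2) by rewrite keep4 // -m8.
rewrite mark /greedy_step -/p -/S /=; case: ifP => _ //.
exact: write_member.
Qed.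

Lemma greedy_steps (s : seq 'I_n) (par : 'I_n -> 'I_n) (m : memory) :
  size s = n -> greedy_state s par n (set0, set0) m ->
  exists t m', [/\ exec (While (reg 0) greedy_body) m t m',
    t <= (expr_cost (reg 0) + cost_bound greedy_body).+1 * n.+1 &
    outputs m' (greedy c par s).1].
Proof.
move=> sn st.
pose I k m := k <= n /\ greedy_state s par (n - k) (greedy c par (drop (n - k) s)) m.
have I0 : I 0 m by rewrite /I subn0 drop_oversize ?sn.
have [//|k m1 [kn st1] cond|t [m' [k [ex tn [kn st1] stop]]]] :=
  exec_while (I := I) (x := reg 0) (p := greedy_body) (N := n) _ _ I0.
  have [m90 _ m5 _] := st1; have {}cond : 0 < n - k.
    by rewrite lt0n -m90; apply/eqP.
  have nk : n - k = (n - k.+1).+1 by lia.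
  split; first lia.
  split; first lia.
  have lt : n - k.+1 < size s by lia.
  pose x0 : 'I_n := Ordinal (leq_trans cond (leq_subr _ _)).
  rewrite (drop_nth x0 lt) -nk; apply: run_greedy_body; rewrite -?nk //.
  by rewrite (m5 _ x0) //; lia.
exists t, m'; split=> //; first by rewrite subn0 in tn.
by case: st1 => m90 _ _ [_ + _]; rewrite -m90 [m' 9 0]stop drop0.
Qed.

End Correctness.

Theorem theorem3 :
  exists (p : program) (K : nat),
    forall (n : nat) (e : rel 'I_n) (c : 'I_n -> nat) (al : 'I_n -> seq 'I_n),
      is_tree e -> coloring e c -> adjacency_lists e al ->
      exists (t : nat) (m : memory),
        [/\ exec p (input_memory al c) t m,
            t <= K * n &
            (exists D : {set 'I_n}, up_color_dominating e c D) ->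
            exists D : {set 'I_n}, outputs m D /\ gamma_uc_dominating e c D].
Proof.
pose C0 := cost_bound search_init.
pose C1 := (expr_cost search_cond + cost_bound search_body).+1.
pose C2 := (expr_cost (reg 0) + cost_bound greedy_body).+1.
exists algorithm, (C0 + C1 * 4 + C2 * 2 + 2) => n e c al tree col adj.
have n_gt0 : 0 < n by case: tree; rewrite card_ord.
have [r [inv0 rnz]] := search_init_invariant tree col adj.
have [//|t0 ex0 t0_le] := @exec_run search_init (input_memory al c).
have [|t1 [m1 [k [ex1 t1_le inv1 stop]]]] :=
  exec_while (x := search_cond) (p := search_body) (N := n + \sum_x size (al x)) isT _ inv0.
  exact: search_step.
have [s [par [so full st]]] := search_complete tree inv1 stop.
have sn : size s = n.
  by have [us _ _ _] := so; rewrite -(card_uniqP us) -[RHS]card_ord; apply: eq_card.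
have deg_le := sum_adjacency_le tree adj so full.
have st2 : greedy_state c al s par n (set0, set0) m1.
  have [[m1E _ _ m4 m8] [m90 _ _] m5 _ m6] := st.
  split=> // [i x0 lt|]; first by rewrite m5 ?sn // (set_nth_default x0) ?sn.
  by split=> [x|x|x]; rewrite ?m6 ?m4 ?m8 ?inE.
have [t2 [m2 [ex2 t2_le out]]] := greedy_steps sn st2.
exists (t0 + (t1 + t2).+1).+1, m2; split.
- exact: ExecSeq ex0 (ExecSeq ex1 ex2).
- have {}t1_le : t1 <= C1 * (4 * n).
    by apply: leq_trans t1_le _; rewrite -/C1 leq_mul2l; lia.
  have {}t2_le : t2 <= C2 * (2 * n).
    by apply: leq_trans t2_le _; rewrite -/C2 leq_mul2l; lia.
  have {}t0_le : t0 <= C0 * n by apply: leq_trans t0_le _; apply: leq_pmulr.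
  by rewrite !mulnDl -!mulnA; lia.
by move=> /rnz cr; exists (greedy c par s).1; split=> //; apply: greedy_gamma_uc so full.
Qed.
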